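(* Assume the Continuum Hypothesis. Then there exists a first countable, zero-dimensional, compact, homogeneous strong $S$-space.
   Context: A space is hereditarily separable (HS) if every subspace of it is separable. An $S$-space is a regular Hausdorff hereditarily separable space which has a non-Lindel\''of subspace. A strong $S$-space is a space $X$ such that $X^n$ is an $S$-space for every positive integer $n$. A space $X$ is homogeneous if for all $x,y \in X$ there is a homeomorphism $f$ of $X$ onto $X$ with $f(x)=y$. *)

(* Defs.v *)
From HB Require Import structures.
From mathcomp Require Import all_boot all_order.
From mathcomp Require Import all_classical all_reals all_analysis.
Set Implicit Arguments. Unset Strict Implicit. Unset Printing Implicit Defensive.
Local Open Scope classical_set_scope.
Local Open Scope card_scope.

Definition CH : Prop :=
  forall A : set (nat -> bool), countable A \/ (A #= [set: nat -> bool]).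

(* A subspace A of X is separable: it has a countable subset dense in A
   (closure in the subspace A = closure in X intersected with A). *)
Definition separable_subspace {X : topologicalType} (A : set X) : Prop :=
  exists2 D : set X, countable D /\ D `<=` A & A `<=` closure D.

Definition hereditarily_separable (X : topologicalType) : Prop :=
  forall A : set X, separable_subspace A.

(* A subspace A of X is Lindelof: every cover of A by open sets of X
   (i.e. every open cover in the subspace topology) has a countable subcover. *)
Definition lindelof_subspace {X : topologicalType} (A : set X) : Prop :=
  forall C : set (set X), C `<=` open -> A `<=` \bigcup_(U in C) U ->
    exists2 D : set (set X), countable D /\ D `<=` C & A `<=` \bigcup_(U in D) U.

Definition S_space (X : topologicalType) : Prop :=
  [/\ regular_space X, hausdorff_space X, hereditarily_separable X &
      exists A : set X, ~ lindelof_subspace A].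

Definition strong_S_space (X : topologicalType) : Prop :=
  forall n : nat, (0 < n)%N -> S_space {ptws 'I_n -> X}.

Definition first_countable (X : topologicalType) : Prop :=
  forall x : X, exists B : set (set X),
    [/\ countable B, B `<=` nbhs x &
        forall U, nbhs x U -> exists2 V, B V & V `<=` U].

Definition zero_dim (X : topologicalType) : Prop :=
  forall (x : X) (U : set X), nbhs x U ->
    exists V : set X, [/\ clopen V, V x & V `<=` U].

Definition homeomorphism {X Y : topologicalType} (f : X -> Y) : Prop :=
  exists g : Y -> X, [/\ continuous f, continuous g, cancel f g & cancel g f].

Definition homogeneous (X : topologicalType) : Prop :=
  forall x y : X, exists f : X -> X, homeomorphism f /\ f x = y.

(* Main.v *)
From HB Require Import structures.
From Stdlib Require Import Inverse_Image.
Require Import Defs.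
From mathcomp Require Import all_boot all_order.
From mathcomp Require Import all_classical all_reals all_analysis.
Set Implicit Arguments. Unset Strict Implicit. Unset Printing Implicit Defensive.
Local Open Scope classical_set_scope.
Local Notation bits := (nat -> bool).

(** The Cantor set [C], well ordered in type omega_1, is refined by a transfinite
    recursion in the style of Juhasz, Kunen and Rudin: each point [x] gets a
    closed set [K x] of points [<= x] containing [x], such that [K x] and [K y]
    agree near [y] whenever [y] is in [K x].  The sets [K x /\ U], [U] a
    Euclidean neighbourhood of [x], then form a neighbourhood base at [x] of a
    finer locally compact topology with countable open initial segments, hence
    not Lindelof.  Under CH, every countable set of finite sequences of points is
    coded by a point [e] of [C], and [K x] is chosen so that [x] becomes a limit
    of every set definable from a code [e < x] and points [< x] of which it is a
    Euclidean limit.  This makes all finite powers hereditarily separable.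

    An Alexandroff duplicate, with the refined topology on the added copy, is a
    first countable compactification [D] of this space, in which the isolated
    points are dense.  Its power [D^nat] inherits all the properties, and in
    addition every nonempty open set contains a clopen copy of the whole space
    (fix finitely many coordinates to be isolated points).  So for any two points
    [x] and [y] one cuts the complements of [x] and [y] into clopen rings and
    matches them by a Cantor-Bernstein back and forth, which extends to a
    homeomorphism taking [x] to [y]. *)

(** * Well-orderings of the Cantor set under CH *)

Lemma well_order_exists (T : Type) : exists lt : T -> T -> Prop,
  [/\ well_founded lt, forall x y z, lt x y -> lt y z -> lt x z &
      forall x y, [\/ x = y, lt x y | lt y x]].
Proof.
have [R Rwo] := wochoice.well_ordering_principle {classic T}.
have minP (A : set T) : A !=set0 ->
    exists z, [/\ A z, (forall y, A y -> R z y) &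
      forall z', A z' -> (forall y, A y -> R z' y) -> z = z'].
  move=> [a Aa]; have [|z [[zA lz] uz]] := Rwo (fun x => `[< A x >]).
    by exists a; apply/asboolP.
  exists z; split.
  - exact/asboolP/zA.
  - by move=> y Ay; apply: lz; apply/asboolP.
  - move=> z' Az' lz'; apply: uz; split; first exact/asboolP.
    by move=> y /asboolP; apply: lz'.
have Rxx x : R x x.
  by have [z [-> /(_ x) + _]] := minP [set x] (ex_intro _ x erefl); apply.
have Ranti x y : R x y -> R y x -> x = y.
  move=> xy yx.
  have [z [_ _ uz]] := minP [set x; y] (ex_intro _ x (or_introl erefl)).
  rewrite -(uz x); last by move=> ? [->|->].
    by apply: uz => [|? [->|->]] //; right.
  by left.
exists (fun x y => R x y /\ x <> y); split.
- move=> x; apply: contrapT => nAx.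
  have [z [nAz zmin _]] := minP [set x | ~ Acc (fun x y => R x y /\ x <> y) x]
    (ex_intro _ x nAx).
  apply: nAz; constructor => y [yz neq_yz]; apply: contrapT => /zmin zy.
  exact/neq_yz/Ranti.
- move=> x y z [xy nxy] [yz nyz]; split; last first.
    by move=> xz; apply: nxy; apply: Ranti => //; rewrite xz.
  have [|m [+ mmin _]] := minP [set x; y; z]; first by exists x; left; left.
  move=> [[mx|my]|mz].
  + by rewrite -mx; apply: mmin; right.
  + by case: nxy; apply: Ranti => //; rewrite -my; apply: mmin; left; left.
  + by case: nyz; apply: Ranti => //; rewrite -mz; apply: mmin; left; right.
- move=> x y; have [->|nxy] := pselect (x = y); first by constructor 1.
  have [|m [+ mmin _]] := minP [set x; y]; first by exists x; left.
  case=> [mx|my].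
  + by constructor 2; split => //; rewrite -mx; apply: mmin; right.
  + by constructor 3; split; [rewrite -my; apply: mmin; left | exact/nesym].
Qed.

(** If some initial segment is uncountable, take the least [p] whose segment is. CH makes this
    segment as large as the Cantor set, and the order is pulled back along an injection into it. *)
Lemma CH_well_order : CH -> exists lt : (nat -> bool) -> (nat -> bool) -> Prop,
  [/\ well_founded lt, forall x y z, lt x y -> lt y z -> lt x z,
      forall x y, [\/ x = y, lt x y | lt y x] &
      forall x, countable [set y | lt y x]].
Proof.
move=> ch; have [lt [wf tr tri]] := well_order_exists (nat -> bool).
have [|/existsNP[p0 np0]] :=
  pselect (forall x, countable [set y | lt y x]); first by exists lt.
have [p [np pmin]] : exists p, ~ countable [set y | lt y p] /\
    forall y, lt y p -> countable [set z | lt z y].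
  elim/(well_founded_ind wf): p0 np0 => p IH np.
  have [|/existsNP[q /not_implyP[qp nq]]] :=
    pselect (forall y, lt y p -> countable [set z | lt z y]); first by exists p.
  exact: IH nq.
have [//|] := ch [set y | lt y p]; rewrite card_eq_sym card_eq_le => /andP[+ _].
move=> /pcard_leP[f].
have finj x y : f x = f y -> x = y.
  by move=> fxy; apply: (@inj _ _ _ f); rewrite ?inE.
exists (fun x y => lt (f x) (f y)); split.
- exact: wf_inverse_image wf.
- by move=> x y z; apply: tr.
- move=> x y; case: (tri (f x) (f y)).
  + by move=> /finj; constructor 1.
  + by constructor 2.
  + by constructor 3.
- move=> x; have fxp : lt (f x) p := @funS _ _ _ _ f x Logic.I.
  have /countable_injP[g ginj] := pmin _ fxp.
  apply/countable_injP; exists (g \o f) => a b /[!inE] /= ax bx /ginj.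
  by rewrite !inE => /(_ ax bx)/finj.
Qed.

(** * Ladders on the Cantor set *)

Definition agree (l : nat) (x y : bits) : Prop :=
  forall k, (k < l)%N -> x k = y k.

Lemma agree_sym l x y : agree l x y -> agree l y x.
Proof. by move=> xy k /xy. Qed.

Lemma agree_trans l x y z : agree l x y -> agree l y z -> agree l x z.
Proof. by move=> xy yz k kl; rewrite xy ?yz. Qed.

Lemma agree_le l m x y : (l <= m)%N -> agree m x y -> agree l x y.
Proof. by move=> lm xy k kl; apply: xy; apply: leq_trans lm. Qed.

Lemma agree_neq x y : x <> y -> exists2 d, agree d x y & x d <> y d.
Proof.
move=> nxy; have ex : exists d, x d != y d.
  apply: contrapT => /forallNP xy; apply: nxy; apply/funext => d.
  by have /negP := xy d; rewrite negbK => /eqP.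
exists (ex_minn ex); case: ex_minnP => d xyd dmin; last exact/eqP.
move=> k kd; apply/eqP; apply: contraLR kd => /dmin.
by rewrite -leqNgt.
Qed.

Lemma agree_diff_uniq x y d e : agree d x y -> x d <> y d ->
  agree e x y -> x e <> y e -> d = e.
Proof.
move=> ad nd ae ne; case: (ltngtP d e) => // [/ae|/ad] //.
Qed.

(* [k] is closed, and coincides with [K z] near each of its points [z]. *)
Definition locally_coded (K : bits -> set bits) (k : set bits) (z : bits) :=
  exists l, forall w, agree l z w -> (k w <-> k z /\ K z w).

Lemma bounded_choice (P : nat -> nat -> Prop) n :
  (forall i l m, (l <= m)%N -> P i l -> P i m) -> (forall i, exists l, P i l) ->
  exists l, forall i, (i <= n)%N -> P i l.
Proof.
move=> Pmon /choice[f Pf]; exists (\max_(i < n.+1) f i) => i ilen.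
apply: Pmon (Pf i); exact: (leq_bigmax (Ordinal (ilen : (i < n.+1)%N))).
Qed.

Lemma countable_enum (T : Type) (t0 : T) (S : set T) : countable S ->
  exists g : nat -> T, forall s, S s -> exists n, g n = s.
Proof.
elim/Pchoice: T => T in t0 S *.
move=> /countable_injP[f finj].
exists (fun n => xget t0 [set t | S t /\ f t = n]) => s Ss; exists (f s).
have [Su /finj] : [set t | S t /\ f t = f s]
    (xget t0 [set t | S t /\ f t = f s]) by apply: xgetPex; exists s.
by rewrite !inE; apply.
Qed.

Lemma countableU (T : Type) (A B : set T) :
  countable A -> countable B -> countable (A `|` B).
Proof.
move=> cA cB.
suff -> : A `|` B = \bigcup_(b : bool) (if b then A else B).
  by apply: bigcup_countable => // -[].
apply/seteqP; split=> [x [Ax|Bx]|x [[] _ ?]]; [by exists true|by exists false|..].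
  by left.
by right.
Qed.

(** Cantor's diagonal started at position [l]: the new point differs from [g n] at [n + l]. *)
Lemma countable_avoid (S : set bits) (x : bits) (l : nat) : countable S ->
  exists2 z, agree l x z & ~ S z.
Proof.
move=> /(countable_enum x)[g gP].
exists (fun k => if (k < l)%N then x k else ~~ g (k - l)%N k) => [k ->//|/gP[n]].
move=> /(congr1 (fun z => z (n + l)%N)).
by rewrite ltnNge leq_addl /= addnK; case: (g n _).
Qed.

Section Ladders.
Variable lt : bits -> bits -> Prop.
Hypothesis wf : well_founded lt.
Hypothesis tr : forall x y z, lt x y -> lt y z -> lt x z.
Hypothesis cnt : forall x, countable [set y | lt y x].

Lemma lt_irr x : ~ lt x x.
Proof. by elim/(well_founded_ind wf): x => x IH xx; apply: (IH x xx). Qed.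

(* On the annulus of points first differing from [x] at [d], the new set is the
   union of [K (y (d, i))] for [i <= d], with [y (d, i)] chosen in [Z i] and in
   the annulus: finitely many clopen pieces on each annulus, and eventually every
   [Z i] is served on every annulus that it meets. *)
Lemma ladder_step (x : bits) (K : bits -> set bits) (Z : nat -> set bits) :
  (forall y, lt y x -> [/\ K y y, forall z, K y z -> z = y \/ lt z y &
     forall z, locally_coded K (K y) z]) ->
  (forall i z, Z i z -> lt z x) ->
  exists k : set bits,
    [/\ k x, forall z, k z -> z = x \/ lt z x,
        forall z, z <> x -> locally_coded K k z &
        forall i, (forall m, exists z, Z i z /\ agree m x z) ->
          forall m, exists z, [/\ Z i z, k z & agree m x z]].
Proof.
move=> KP Zlt.
have /choice[y yP] : forall di : nat * nat, exists y,
    (exists z, [/\ Z di.2 z, agree di.1 x z & x di.1 <> z di.1]) ->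
    [/\ Z di.2 y, agree di.1 x y & x di.1 <> y di.1].
  move=> di; have [[z zP]|nz] := pselect (exists z,
    [/\ Z di.2 z, agree di.1 x z & x di.1 <> z di.1]); first by exists z.
  (* The default [x] creates no piece, since [Z i] lies below [x] and so omits it. *)
  by exists x => /nz.
exists [set z | z = x \/ exists d i, [/\ (i <= d)%N, agree d x z, x d <> z d,
  Z i (y (d, i)) & K (y (d, i)) z]]; split.
- by left.
- move=> z [->|[d [i [_ _ _ /Zlt yx Kz]]]]; first by left.
  have [_ /(_ z Kz)[->|zy] _] := KP _ yx; right => //.
  exact: tr zy yx.
- move=> z zx; have [d xz nxz] := agree_neq (nesym zx).
  (* Only the finitely many pieces with [i <= d] matter on the annulus of [z], so one radius serves
     them all. *)
  have [l lP] : exists l, forall i, (i <= d)%N -> Z i (y (d, i)) ->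
      forall w, agree l z w -> (K (y (d, i)) w <-> K (y (d, i)) z /\ K z w).
    apply: bounded_choice => [i l m lm + Zi w|i].
      by move=> /(_ Zi w) + /(agree_le lm).
    have [Zi|nZi] := pselect (Z i (y (d, i))); last by exists 0%N => /nZi.
    by have [_ _ /(_ z)[l]] := KP _ (Zlt _ _ Zi); exists l.
  exists (maxn l d.+1) => w zw.
  have lzw : agree l z w by apply: agree_le zw; rewrite leq_maxl.
  have dzw : agree d.+1 z w by apply: agree_le zw; rewrite leq_maxr.
  have xw : agree d x w by apply: agree_trans xz _; apply: agree_le dzw.
  have nxw : x d <> w d by rewrite -dzw.
  split.
    move=> [wx|[e [i [ie xwe nxwe Zi Ki]]]]; first by case: nxw; rewrite wx.
    have ed := agree_diff_uniq xwe nxwe xw nxw; subst e.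
    have [Kz Kzw] := proj1 (lP i ie Zi w lzw) Ki.
    by split => //; right; exists d, i.
  move=> [[//|[e [i [ie xze nxze Zi Ki]]]] Kzw].
  have ed := agree_diff_uniq xze nxze xz nxz; subst e.
  right; exists d, i; split => //.
  by apply/(lP i ie Zi w lzw).
(* Agreement up to [maxn m i] puts [z] on an annulus [d >= i], where a piece for [Z i] is
   present. *)
- move=> i Zx m; have [z [Ziz xz]] := Zx (maxn m i).
  have zx : x <> z.
    by move=> xzE; apply: (@lt_irr x); rewrite {1}xzE; exact: Zlt Ziz.
  have [d xzd nxzd] := agree_neq zx.
  have md : (maxn m i <= d)%N.
    by rewrite leqNgt; apply/negP => /xz.
  have [|Zy xy nxy] := yP (d, i); first by exists z.
  have [Kyy _ _] := KP _ (Zlt _ _ Zy).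
  exists (y (d, i)); split => //.
    by right; exists d, i; split => //; apply: leq_trans md; rewrite leq_maxr.
  by apply: agree_le xy => /=; apply: leq_trans md; rewrite leq_maxl.
Qed.

Hypothesis tri : forall x y, [\/ x = y, lt x y | lt y x].

(** The closed initial segments of the points of [S] have a countable union; any point outside it is
    above them all. *)
Lemma countable_bounded (S : set bits) : countable S ->
  exists y, forall x, S x -> lt x y.
Proof.
move=> cS.
have cU : countable (\bigcup_(x in S) (x |` [set y | lt y x])).
  by apply: bigcup_countable => // x _; apply: countableU => //; exact: cnt.
have [y _ nSy] := countable_avoid (fun=> true) 0 cU.
exists y => x Sx; case: (tri x y) => // [xy|yx]; case: nSy; exists x => //.
  by left.
by right.
Qed.

(* A point of the Cantor set read as a sequence (in [t]) of sequences (in [j]). *)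
Definition decode_bits (e : bits) (t j : nat) : bits :=
  fun k => e (pickle (t, j, k)).

(* The [i]-th coordinates below [x] of those terms of the sequence coded by [e]
   whose coordinates in [F] (resp. [G]) are Euclidean [l]-close to [p j] (resp.
   lie in [K (p j)]). *)
Definition slice (K : bits -> set bits) (x e : bits) (i l : nat) (F G : seq nat)
    (p : nat -> bits) : set bits :=
  [set z | lt z x /\ exists t, [/\ z = decode_bits e t i,
     forall j, j \in F -> agree l (p j) (decode_bits e t j) &
     forall j, j \in G -> K (p j) (decode_bits e t j)]].

(** The demands on the value at [x], given [K] below [x]. By the last clause [x] remains a limit,
    along [k], of each slice with parameters below [x] of which it is a Euclidean limit. *)
Definition ladder (K : bits -> set bits) (x : bits) (k : set bits) : Prop :=
  [/\ k x, forall z, k z -> z = x \/ lt z x,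
      forall z, z <> x -> locally_coded K k z &
      forall e i l F G p, lt e x -> (forall j, j \in F ++ G -> lt (p j) x) ->
       (forall m, exists z, slice K x e i l F G p z /\ agree m x z) ->
       forall m, exists z, [/\ slice K x e i l F G p z, k z & agree m x z]].

Lemma ladder_local K K' x k : (forall y, lt y x -> K y = K' y) ->
  ladder K x k -> ladder K' x k.
Proof.
move=> KK' [kx klt kK kS]; split => //.
  move=> z zx; have [l lP] := kK z zx; exists l => w /lP ->.
  by split=> -[kz]; (have [//|/KK' ->] := klt _ kz).
move=> e i l F G p ex px.
suff -> : slice K' x e i l F G p = slice K x e i l F G p by apply: kS.
rewrite /slice; apply/seteqP; split=> z [zx [t [zt tF tG]]]; split => //;
  exists t; split => // j jG; have := tG _ jG; rewrite KK' //;
  by apply: px; rewrite mem_cat jG orbT.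
Qed.

(** Only countably many slices have parameters below [x]: the values of [p] on [F ++ G] are recorded
    by a finite list of indices of points below [x]. *)
Lemma ladder_exists K x :
  (forall y, lt y x -> [/\ K y y, forall z, K y z -> z = y \/ lt z y &
     forall z, locally_coded K (K y) z]) ->
  exists k, ladder K x k.
Proof.
move=> KP.
have [g gP] : exists g : nat -> bits, forall y, lt y x -> exists n, g n = y.
  exact: (countable_enum x (cnt x)).
pose Z n : set bits := if unpickle n is
  Some (h, i, l, F, G, s) then slice K x (g h) i l F G (fun j => g (nth 0%N s j))
  else set0.
have [|k [kx klt kK kZ]] := @ladder_step x K Z KP.
  move=> n z; rewrite /Z; case: unpickle => [[[[[[h i] l] F] G] s]|] //.
  by case.
exists k; split => // e i l F G p ex px.
have [h he] := gP _ ex.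
have /choice[f fP] : forall j, exists n, j \in F ++ G -> g n = p j.
  move=> j; have [/px/gP[n gn]|_] := boolP (j \in F ++ G); first by exists n.
  by exists 0%N.
pose s := mkseq f (\max_(j <- F ++ G) j).+1.
have sP j : j \in F ++ G -> g (nth 0%N s j) = p j.
  move=> jFG; rewrite nth_mkseq; first exact: fP.
  by rewrite ltnS; apply: leq_bigmax_seq.
have ZE : Z (pickle (h, i, l, F, G, s)) = slice K x e i l F G p.
  rewrite /Z pickleK he; apply/seteqP.
  by split=> z [zx [t [zt tF tG]]]; split=> //; exists t; split=> // j j1;
    [have := tF _ j1|have := tG _ j1|have := tF _ j1|have := tG _ j1];
    rewrite sP // mem_cat j1 ?orbT.
by rewrite -ZE; apply: kZ.
Qed.

(** [Phi] receives [K] truncated to the points below [x], with the empty set elsewhere, in place of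
    a dependently typed function. *)
Lemma wf_recursion (Phi : bits -> (bits -> set bits) -> set bits) :
  exists K : bits -> set bits, forall x,
    K x = Phi x (fun y => if `[< lt y x >] then K y else set0).
Proof.
pose F x (rec : forall y, lt y x -> set bits) :=
  Phi x (fun y => if pselect (lt y x) is left h then rec y h else set0).
exists (Fix wf (fun _ => set bits) F) => x.
rewrite Fix_eq => [|{}x f f' ff'].
  congr (Phi x _); apply/funext => y; rewrite /asbool.
  by case: pselect.
by congr (F _); apply/functional_extensionality_dep => y; apply/funext => h.
Qed.

Lemma ladders_exist : exists K : bits -> set bits, forall x,
  [/\ K x x, forall z, K x z -> z = x \/ lt z x,
      forall z, locally_coded K (K x) z & ladder K x (K x)].
Proof.
have [K KE] := wf_recursion (fun x K => xget set0 [set k | ladder K x k]).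
exists K; elim/(well_founded_ind wf) => x IH.
suff H : ladder K x (K x).
  have [kx klt kK _] := H; split => // z.
  have [->|] := pselect (z = x); last exact: kK.
  by exists 0%N => w _; split=> [|[]].
have loc y : lt y x -> K y = if `[< lt y x >] then K y else set0.
  by move=> yx; rewrite asboolT.
have [|k kP] := @ladder_exists K x; first by move=> y /IH[].
apply: (@ladder_local (fun y => if `[< lt y x >] then K y else set0)) => [y yx|].
  by rewrite -loc.
rewrite (KE x).
apply: (@xgetPex _ set0 [set k | ladder _ x k]); exists k.
exact: ladder_local kP.
Qed.

End Ladders.

(** * The duplicate *)

(** An alias indexed by [K], so that the topology declared on it can depend on [K]. *)
Definition dup (K : bits -> set bits) : Type := (bits * bool)%type.

(* [(x, true)] is the Euclidean copy of [x], [(x, false)] the refined one. *)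
Definition ladder_copy (K : bits -> set bits) (x : bits) : set (dup K) :=
  [set w | w.2 = false /\ K x w.1].
Arguments ladder_copy K x : clear implicits.

(** Basic neighbourhoods: a refined point gets the part of its ladder in a cylinder, a Euclidean
    point gets the rest of the two-copy cylinder. *)
Definition dball (K : bits -> set bits) (z : dup K) (l : nat) : set (dup K) :=
  [set w | agree l z.1 w.1] `&`
  (if z.2 then ~` ladder_copy K z.1 else ladder_copy K z.1).

Lemma dball_le K (z : dup K) l m : (l <= m)%N -> dball z m `<=` dball z l.
Proof. by move=> lm w [/(agree_le lm)]. Qed.

Definition dopen K : set_system (dup K) :=
  [set U | forall z, U z -> exists l, dball z l `<=` U].

Lemma dopenT K : dopen (@setT (dup K)).
Proof. by move=> z _; exists 0%N. Qed.

Lemma dopenI K : setI_closed (@dopen K).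
Proof.
move=> U V Uo Vo z [/Uo[l lU] /Vo[m mV]]; exists (maxn l m) => w zw; split.
  by apply/lU/dball_le/zw; rewrite leq_maxl.
by apply/mV/dball_le/zw; rewrite leq_maxr.
Qed.

Lemma dopen_bigU K (I : Type) (f : I -> set (dup K)) :
  (forall i, dopen (f i)) -> dopen (\bigcup_i f i).
Proof.
move=> fo z [i _ /fo[l lf]]; exists l; apply: subset_trans lf _.
exact: bigcup_sup.
Qed.

HB.instance Definition _ K := gen_eqMixin (dup K).
HB.instance Definition _ K := gen_choiceMixin (dup K).
HB.instance Definition _ K :=
  isOpenTopological.Build (dup K) (@dopenT K) (@dopenI K) (@dopen_bigU K).

Section Dup.
Variable K : bits -> set bits.
Hypothesis Kx : forall x, K x x.
Hypothesis Kloc : forall x z, locally_coded K (K x) z.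

Lemma dup_openE (U : set (dup K)) :
  open U <-> forall z, U z -> exists l, dball z l `<=` U.
Proof. by []. Qed.

Lemma dball_center (z : dup K) l : dball z l z.
Proof. by split => //; case: z => x [] /=; [case|split; [|exact: Kx]]. Qed.

Lemma clopen_cylinder l x : clopen [set w : dup K | agree l x w.1].
Proof.
split; last rewrite -openC; apply/dup_openE => z /= xz; exists l => w [zw _] /=.
  exact: agree_trans xz zw.
by move=> xw; apply/xz/(agree_trans xw)/agree_sym.
Qed.

(** By local coding [K x] is, near [z], either [K z] or empty. In both cases small balls around
    [(z, true)], which omit [K z], miss it. *)
Lemma clopen_ladder_copy x : clopen (ladder_copy K x).
Proof.
split; last rewrite -openC; apply/dup_openE => -[z b].
  move=> /= [/= -> xz]; have [l lP] := Kloc x z; exists l => -[w c] [/= zw].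
  move=> [/= -> zKw]; split => //=; exact/(lP w zw).
move=> /= nxz; have [l lP] := Kloc x z; exists l => -[w c] [/= zw].
case: b nxz => /= nxz.
  move=> nzw [/= cf] /(lP w zw)[xKz zKw]; exact: nzw.
move=> [/= -> zKw] [_] /= /(lP w zw)[xKz _]; exact: nxz.
Qed.

Lemma clopen_dball (z : dup K) l : clopen (dball z l).
Proof.
apply: clopenI; first exact: clopen_cylinder.
by case: z.2; [apply: (clopenC set0)|]; exact: clopen_ladder_copy.
Qed.

Lemma dup_nbhsP (z : dup K) (U : set (dup K)) :
  nbhs z U -> exists l, dball z l `<=` U.
Proof.
rewrite nbhsE => -[V [Vo Vz] VU]; have [l lV] := Vo z Vz; exists l.
exact: subset_trans VU.
Qed.

Lemma dball_separates (z w : dup K) : z <> w -> exists l, ~ dball z l w.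
Proof.
case: z w => [z b] [w c] zw; have [zwE|/agree_neq[d zwd nzwd]] := pselect (z = w).
  subst w; exists 0%N => -[_] /=; case: b c zw => -[] //= _; last by case.
  by case; split => //; exact: Kx.
by exists d.+1 => -[/= /(_ d (ltnSn d))].
Qed.

Lemma dup_hausdorff : hausdorff_space (dup K).
Proof.
rewrite open_hausdorff => z w /eqP/dball_separates[l nw].
have [zo zc] := clopen_dball z l.
exists (dball z l, ~` dball z l); split => //=.
- by rewrite inE; exact: dball_center.
- by rewrite inE.
- by rewrite openC.
- by apply/eqP; exact: setICr.
Qed.

(** An ultrafilter decides every bit, which yields a Euclidean limit [x]; deciding [ladder_copy K x]
    then selects the copy of [x] it converges to. *)
Lemma dup_compact : compact [set: dup K].
Proof.
rewrite compact_ultra => F FU _.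
have coord k : exists b, F [set w : dup K | w.1 k = b].
  have [Ft|Ff] := in_ultra_setVsetC [set w : dup K | w.1 k = true] FU.
    by exists true.
  by exists false; apply: filterS Ff => w /= /negP; case: (w.1 k).
have /choice[x xP] := coord.
have Fx l : F [set w : dup K | agree l x w.1].
  elim: l => [|l IH]; first by apply: filterS filterT.
  apply: filterS (filterI IH (xP l)) => w [xw wl] k; rewrite ltnS leq_eqVlt.
  by move=> /orP[/eqP ->//|/xw].
have [b Fb] : exists b, F (if b then ~` ladder_copy K x else ladder_copy K x).
  have [?|?] := in_ultra_setVsetC (ladder_copy K x) FU; first by exists false.
  by exists true.
exists (x, b); split => // U /dup_nbhsP[l lU].
by apply: filterS lU _; apply: filterI.
Qed.

End Dup.

(** * Pointwise topology *)

Section Ptws.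
Variables (I : eqType) (X : topologicalType).

Lemma ptws_cvgP (F : set_system {ptws I -> X}) (f : {ptws I -> X}) :
  Filter F -> (forall i, (fun g : {ptws I -> X} => g i) @ F --> f i) -> F --> f.
Proof.
move=> FF Ff; apply/cvg_sup => i U [V [[W] oW <-] WfN WU].
apply: filterS WU _; apply: Ff; exact: open_nbhs_nbhs.
Qed.

Lemma ptws_continuous (Z : topologicalType) (h : Z -> {ptws I -> X}) :
  (forall i, continuous (fun z => h z i)) -> continuous h.
Proof. by move=> hc z; apply: ptws_cvgP => i; exact: hc. Qed.

Lemma ptws_eval_continuous i : continuous (fun f : {ptws I -> X} => f i).
Proof. exact: (@proj_continuous I (fun=> X) i). Qed.

(** The sets containing a finite box around [f] form a filter that converges coordinatewise, hence
    converges, to [f]. *)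
Lemma ptws_box (f : {ptws I -> X}) U : nbhs f U ->
  exists (s : seq I) (V : I -> set X), (forall i, nbhs (f i) (V i)) /\
    forall g : {ptws I -> X}, (forall i, i \in s -> V i (g i)) -> U g.
Proof.
pose F : set_system {ptws I -> X} := [set U | exists (s : seq I) (V : I -> set X),
  (forall i, nbhs (f i) (V i)) /\
    forall g : {ptws I -> X}, (forall i, i \in s -> V i (g i)) -> U g].
have FF : Filter F.
  split.
  - by exists [::], (fun=> setT); split => // i; exact: filterT.
  - move=> A B [s [V [fV VA]]] [t [W [fW WB]]].
    exists (s ++ t), (fun i => V i `&` W i); split=> [i|g gVW]; first exact: filterI.
    split; [apply: VA => i si|apply: WB => i si];
      by have [] := gVW i; rewrite // mem_cat si ?orbT.
  - by move=> A B AB [s [V [fV VA]]]; exists s, V; split => // g /VA/AB.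
suff : F --> f by apply.
apply: ptws_cvgP => i V fV.
exists [:: i], (fun j => [set x | j = i -> V x]); split.
  move=> j; have [->|ji] := pselect (j = i).
    by apply: filterS fV => x Vx.
  by apply: filterS filterT => x _ /ji.
by move=> g /(_ i (mem_head _ _)) /=; apply.
Qed.

End Ptws.

(** * Homogeneity from clopen self-embeddings *)

(** Away from [x] the map is locally one [u i]; at [x] it is continuous because pieces [A i] meeting
    a small neighbourhood of [x] have targets [B i] close to [y]. *)
Lemma continuous_glue (T : topologicalType) (I : Type) (A B : I -> set T)
    (u : I -> T -> T) (x y : T) :
  (forall i, open (A i)) -> (forall i, ~ A i x) ->
  (forall i j z, A i z -> A j z -> i = j) ->
  (forall z, z <> x -> exists i, A i z) ->
  (forall i, continuous (u i)) -> (forall i z, A i z -> B i (u i z)) ->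
  (forall V, nbhs y V -> exists2 U, nbhs x U &
     forall z i, U z -> A i z -> B i `<=` V) ->
  exists f : T -> T,
    [/\ f x = y, forall i z, A i z -> f z = u i z & continuous f].
Proof.
move=> Ao nAx Auniq Acov uc uB lim.
have /choice[f fP] : forall z, exists w, (z = x -> w = y) /\
    forall i, A i z -> w = u i z.
  move=> z; have [->|/[dup] zx /Acov[i Aiz]] := pselect (z = x).
    by exists y; split => // i /nAx.
  by exists (u i z); split => // j /(Auniq _ _ _ Aiz) ->.
have fx : f x = y by apply (fP x).1.
exists f; split => // [i z /((fP z).2)//|z].
have [->|/Acov[i Aiz]] := pselect (z = x).
  move=> V; rewrite fx => yV; have [U xU UV] := lim V yV.
  apply: filterS xU => w Uw; have [wx|/Acov[i Aiw]] := pselect (w = x).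
    by rewrite /= wx fx; exact: nbhs_singleton.
  by rewrite /= ((fP w).2 i Aiw); exact: (UV _ _ Uw Aiw _ (uB _ _ Aiw)).
move=> V; rewrite ((fP z).2 i Aiz) => /uc uV.
have zA : nbhs z (A i) by apply: open_nbhs_nbhs; split.
by apply: filterS (filterI zA uV) => w [Aiw Vw]; rewrite /= ((fP w).2 i Aiw).
Qed.

Section Homogeneous.
Variables (T : topologicalType) (b : T -> nat -> set T).
Hypothesis b0 : forall x, b x 0 = setT.
Hypothesis b_clopen : forall x n, clopen (b x n).
Hypothesis b_center : forall x n, b x n x.
Hypothesis b_le : forall x m n, (m <= n)%N -> b x n `<=` b x m.
Hypothesis b_base : forall x U, nbhs x U -> exists n, b x n `<=` U.
Hypothesis b_sep : forall x z, x <> z -> exists n, ~ b x n z.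
Hypothesis b_strict : forall x n, (b x n `\` b x n.+1) !=set0.
Hypothesis embed : forall V : set T, open V -> V !=set0 ->
  exists h r : T -> T, [/\ continuous h, continuous r, cancel h r,
    clopen (range h) & range h `<=` V].

Let ring x n := b x n `\` b x n.+1.

Lemma ring_clopen x n : clopen (ring x n).
Proof. by rewrite /ring setDE; apply: clopenI => //; exact: (clopenC set0). Qed.

Lemma ring_uniq x m n z : ring x m z -> ring x n z -> m = n.
Proof.
move=> [bm nbm] [bn nbn]; case: (ltngtP m n) => // [mn|nm].
- by case: nbm; apply: b_le bn.
- by case: nbn; apply: b_le bm.
Qed.

Lemma ring_cover x z : z <> x -> exists n, ring x n z.
Proof.
move=> /nesym/b_sep ex.
have exb : exists n, `[< ~ b x n z >] by case: ex => n nb; exists n; apply/asboolP.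
case: (ex_minnP exb) => -[|n] /asboolP nbz nmin; first by case: nbz; rewrite b0.
exists n; split => //; apply: contrapT => nb.
by have := nmin n (asboolT nb); rewrite ltnn.
Qed.

Lemma ring_center x n : ~ ring x n x.
Proof. by case=> _; apply; exact: b_center. Qed.

Lemma image_cancel (h r : T -> T) (S : set T) : cancel h r ->
  h @` S = range h `&` r @^-1` S.
Proof.
move=> hr; apply/seteqP; split=> [_ [z Sz <-]|_ [[z _ <-]]] /=.
  by split; [exists z | rewrite /= hr].
by rewrite hr => Sz; exists z.
Qed.

Lemma clopen_image (h r : T -> T) (S : set T) : continuous r -> cancel h r ->
  clopen (range h) -> clopen S -> clopen (h @` S).
Proof.
move=> rc hr hcl Scl; rewrite (image_cancel _ hr); apply: clopenI => //.
exact: preimage_clopen.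
Qed.

Lemma homogeneous_of_embeddings : homogeneous T.
Proof.
move=> x y.
have emb z n : exists hr : (T -> T) * (T -> T),
    [/\ continuous hr.1, continuous hr.2, cancel hr.1 hr.2,
      clopen (range hr.1) & range hr.1 `<=` ring z n].
  have [zo _] := ring_clopen z n; have [h [r hrP]] := embed zo (b_strict z n).
  by exists (h, r).
have /choice[E EP] := emb y; have /choice[D DP] := fun n => emb x n.+1.
(* [P k] is what the back step leaves of the ring [k] of [x]; [Q k (P k)] is what
   [P k] then leaves of the ring [k] of [y], to be sent back into ring [k+1]. *)
pose Q (k : nat) (P : set T) := ring y k `\` (E k).1 @` P.
pose P := fix P k := if k is k'.+1 then ring x k `\` (D k').1 @` Q k' (P k')
  else ring x 0.
(* Matched pieces: [u i] maps [A i] onto [B i] with inverse [v i]. Flag [false] is the forward step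
   by [E k]; flag [true] inverts the back step by [D k]. *)
pose A (i : nat * bool) := if i.2 then (D i.1).1 @` Q i.1 (P i.1) else P i.1.
pose B (i : nat * bool) := if i.2 then Q i.1 (P i.1) else (E i.1).1 @` P i.1.
pose u (i : nat * bool) := if i.2 then (D i.1).2 else (E i.1).1.
pose v (i : nat * bool) := if i.2 then (D i.1).1 else (E i.1).2.
have Pring k : P k `<=` ring x k by case: k => [|k] //= z [].
have embE z n (hr : (T -> T) * (T -> T)) S :
    [/\ continuous hr.1, continuous hr.2, cancel hr.1 hr.2,
      clopen (range hr.1) & range hr.1 `<=` ring z n] ->
    clopen S -> clopen (hr.1 @` S).
  by move=> [_ ? ? ? _]; exact: clopen_image.
have Qcl j S : clopen S -> clopen (Q j S).
  move=> Scl; rewrite /Q setDE; apply: clopenI; first exact: ring_clopen.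
  apply: (clopenC set0); exact: embE (EP j) Scl.
have Pcl k : clopen (P k).
  elim: k => [|k IH]; first exact: ring_clopen.
  rewrite /= setDE; apply: clopenI; first exact: ring_clopen.
  by apply: (clopenC set0); apply: embE (DP k) _; exact: Qcl.
have Acl i : clopen (A i).
  by rewrite /A; case: i.2 => //; apply: embE (DP i.1) _; exact: Qcl.
have Bcl i : clopen (B i).
  by rewrite /B; case: i.2; [exact: Qcl | exact: embE (EP i.1) _].
have Aring i : A i `<=` ring x (i.1 + i.2).
  rewrite /A; case: i => k [] /=; last by rewrite addn0; exact: Pring.
  have [_ _ _ _ Dr] := DP k; rewrite addn1; apply: subset_trans Dr.
  exact: image_subset.
have Bring i : B i `<=` ring y i.1.
  rewrite /B; case: i => k [] /=; first by move=> z [].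
  have [_ _ _ _ Er] := EP k; apply: subset_trans Er; exact: image_subset.
have uc i : continuous (u i).
  by rewrite /u; case: i.2; [have [] := DP i.1|have [] := EP i.1].
have vc i : continuous (v i).
  by rewrite /v; case: i.2; [have [] := DP i.1|have [] := EP i.1].
have uv i z : A i z -> B i (u i z) /\ v i (u i z) = z.
  rewrite /A /B /u /v; case: i.2; last first.
    by have [_ _ hr _ _] := EP i.1; split; [exists z | rewrite hr].
  by have [_ _ hr _ _] := DP i.1; move=> [w Qw <-]; rewrite hr.
have vu i z : B i z -> A i (v i z) /\ u i (v i z) = z.
  rewrite /A /B /u /v; case: i.2.
    by have [_ _ hr _ _] := DP i.1; split; [exists z | rewrite hr].
  by have [_ _ hr _ _] := EP i.1; move=> [w Qw <-]; rewrite hr.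
have Auniq i j z : A i z -> A j z -> i = j.
  move=> Ai Aj; have := ring_uniq (Aring _ _ Ai) (Aring _ _ Aj).
  case: i j Ai Aj => [k []] [j []]; rewrite /A /= ?addn0 ?addn1.
  - by move=> _ _ [->].
  - by move=> Dz + kj; rewrite -kj => -[].
  - by move=> + Dz kj; rewrite kj => -[].
  - by move=> _ _ ->.
have Buniq i j z : B i z -> B j z -> i = j.
  move=> Bi Bj; have := ring_uniq (Bring _ _ Bi) (Bring _ _ Bj).
  case: i j Bi Bj => [k []] [j []]; rewrite /B /=.
  - by move=> _ _ ->.
  - by move=> [_ nE] + kj; rewrite -kj => /nE.
  - by move=> + [_ nE] kj; rewrite kj => /nE.
  - by move=> _ _ ->.
have Acov z : z <> x -> exists i, A i z.
  move=> /ring_cover[[|k] xz]; first by exists (0%N, false).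
  have [Dz|nDz] := pselect (((D k).1 @` Q k (P k)) z); first by exists (k, true).
  by exists (k.+1, false).
have Bcov z : z <> y -> exists i, B i z.
  move=> /ring_cover[k yz].
  have [Ez|nEz] := pselect (((E k).1 @` P k) z); first by exists (k, false).
  by exists (k, true).
have limA V : nbhs y V -> exists2 U, nbhs x U &
    forall z i, U z -> A i z -> B i `<=` V.
  (* [n.+1] and not [n]: a piece in ring [k.+1] of [x] may be matched with ring [k] of [y]. *)
  move=> /b_base[n nV]; exists (b x n.+1).
    by apply: open_nbhs_nbhs; split => //; have [] := b_clopen x n.+1.
  move=> z i xz /Aring[_ nxz]; apply: subset_trans (Bring i) _ => w [yw _].
  apply: nV; apply: b_le yw; rewrite leqNgt; apply/negP => ni.
  apply: nxz; apply: b_le xz; rewrite ltnS.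
  by case: i.2; rewrite ?addn0 ?addn1 // ltnW.
have limB V : nbhs x V -> exists2 U, nbhs y U &
    forall z i, U z -> B i z -> A i `<=` V.
  move=> /b_base[n nV]; exists (b y n).
    by apply: open_nbhs_nbhs; split => //; have [] := b_clopen y n.
  move=> z i yz /Bring[_ nyz]; apply: subset_trans (Aring i) _ => w [xw _].
  apply: nV; apply: b_le xw; apply: leq_trans (leq_addr _ _).
  by rewrite leqNgt; apply/negP => ni; apply: nyz; apply: b_le yz.
have [f [fx fA fc]] : exists f : T -> T,
    [/\ f x = y, forall i z, A i z -> f z = u i z & continuous f].
  apply: (@continuous_glue _ _ A B) => // i; first by have [] := Acl i.
    by move=> /Aring/ring_center.
  by move=> z /uv[].
have [g [gy gB gc]] : exists g : T -> T,
    [/\ g y = x, forall i z, B i z -> g z = v i z & continuous g].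
  apply: (@continuous_glue _ _ B A) => // i; first by have [] := Bcl i.
    by move=> /Bring/ring_center.
  by move=> z /vu[].
exists f; split => //; exists g; split => // z.
- have [->|/Acov[i Aiz]] := pselect (z = x); first by rewrite fx.
  by have [Bu vuz] := uv _ _ Aiz; rewrite (fA _ _ Aiz) (gB i).
- have [->|/Bcov[i Biz]] := pselect (z = y); first by rewrite gy.
  by have [Av uvz] := vu _ _ Biz; rewrite (gB _ _ Biz) (fA i).
Qed.

End Homogeneous.

(** * The countable power of the duplicate *)

Lemma clopen_forall_lt (T : topologicalType) (P : nat -> set T) n :
  (forall j, clopen (P j)) -> clopen [set z | forall j, (j < n)%N -> P j z].
Proof.
move=> Pcl; elim: n => [|n IH].
  by rewrite (_ : mkset _ = setT); [exact: clopenT | apply/seteqP; split].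
rewrite (_ : mkset _ = [set z | forall j, (j < n)%N -> P j z] `&` P n).
  exact: clopenI.
apply/seteqP; split=> [z Pz|z [Pz Pn] j].
  by split=> [j jn|]; apply: Pz => //; exact: ltnW.
by rewrite ltnS leq_eqVlt => /orP[/eqP ->|/Pz].
Qed.

Section DupPower.
Variables (lt : bits -> bits -> Prop) (K : bits -> set bits).
Hypothesis wf : well_founded lt.
Hypothesis cnt : forall x, countable [set y | lt y x].
Hypothesis Kx : forall x, K x x.
Hypothesis Klt : forall x z, K x z -> z = x \/ lt z x.
Hypothesis Kloc : forall x z, locally_coded K (K x) z.

Lemma K_countable x : countable (K x).
Proof.
apply: (@sub_countable _ _ _ ([set x] `|` [set y | lt y x])).
  by apply: subset_card_le => z /Klt[->|]; [left|right].
exact: countableU.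
Qed.

(** The [lt]-least point [y] of [K x] in the cylinder works: near [y], the ladder [K y] lies in
    [K x], and its points are at most [y]. *)
Lemma isolated_in_ladder x l :
  exists y, [/\ K x y, agree l x y & open [set ((y, false) : dup K)]].
Proof.
have [y [Kxy xy ymin]] : exists y, [/\ K x y, agree l x y &
    forall z, lt z y -> ~ (K x z /\ agree l x z)].
  have : exists y, K x y /\ agree l x y by exists x; split.
  case=> y; elim/(well_founded_ind wf): y => y IH [Kxy xy].
  have [[z [zy Kz]]|nz] := pselect (exists z, lt z y /\ K x z /\ agree l x z).
    exact: IH zy Kz.
  by exists y; split => // z zy Kz; apply: nz; exists z.
exists y; split => //; apply/dup_openE => _ /= ->.
have [m mP] := Kloc x y; exists (maxn l m) => -[w c] [/= yw [/= -> Kyw]].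
have Kxw : K x w by apply/(mP w) => //; apply: agree_le yw; rewrite leq_maxr.
have xw : agree l x w.
  by apply: agree_trans xy _; apply: agree_le yw; rewrite leq_maxl.
by have [->//|/ymin] := Klt Kyw; case.
Qed.

Lemma isolated_dense (z : dup K) l : exists2 d, dball z l d & open [set d].
Proof.
case: z => x [].
  (* Near a Euclidean point, pass to some [y] outside the countable [K x], then to an isolated point
     so close to [y] that it stays outside [K x]. *)
  have [y xy nKy] := countable_avoid x l (K_countable x).
  have [m mP] := Kloc x y.
  have [z [Kyz yz zo]] := isolated_in_ladder y (maxn l m).
  exists (z, false) => //; split => /=.
    by apply: agree_trans xy _; apply: agree_le yz; rewrite leq_maxl.
  have yz' : agree m y z by apply: agree_le yz; rewrite leq_maxr.
  by case=> _ /= /(mP z yz')[].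
have [y [Kxy xy yo]] := isolated_in_ladder x l.
by exists (y, false) => //; split.
Qed.

Local Notation X := {ptws nat -> dup K}.

(** One number bounds both the coordinates and the radius, so each point gets a decreasing base
    indexed by [nat]. *)
Definition box (f : X) (n : nat) : set X :=
  [set g | forall j, (j < n)%N -> dball (f j) n (g j)].

Lemma clopen_box f n : clopen (box f n).
Proof.
have cl j m : clopen [set g : X | dball (f j) m (g j)].
  apply: (@preimage_clopen X (dup K) (fun g => g j)).
    exact: clopen_dball.
  exact: ptws_eval_continuous.
exact: clopen_forall_lt (cl^~ n).
Qed.

Lemma box0 f : box f 0 = setT.
Proof. by apply/seteqP; split. Qed.

Lemma box_center f n : box f n f.
Proof. by move=> j _; exact: dball_center. Qed.

Lemma box_le f m n : (m <= n)%N -> box f n `<=` box f m.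
Proof.
move=> mn g fg j jm; exact: (dball_le mn (fg j (leq_trans jm mn))).
Qed.

Lemma box_base f U : nbhs f U -> exists n, box f n `<=` U.
Proof.
move=> /ptws_box[s [V [fV VU]]].
have /choice[l lP] := fun j => dup_nbhsP (fV j).
exists (\max_(j <- s) maxn j.+1 (l j)) => g fg; apply: VU => i si.
have := @leq_bigmax_seq _ s xpredT (fun j => maxn j.+1 (l j)) i si isT.
move=> /= le; apply: lP; apply: (dball_le (leq_trans (leq_maxr i.+1 _) le)).
by apply: fg; apply: leq_trans le; rewrite leq_maxl.
Qed.

Lemma box_sep f g : f <> g -> exists n, ~ box f n g.
Proof.
move=> fg; have [j jP] : exists j, f j <> g j.
  apply: contrapT => /forallNP H; apply: fg; apply/funext => j.
  by apply: contrapT; exact: H.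
have [l nl] := dball_separates Kx jP; exists (maxn l j.+1) => /(_ j).
rewrite leq_maxr => /(_ isT) /(dball_le (leq_maxl l j.+1)); exact: nl.
Qed.

Lemma box_strict f n : (box f n `\` box f n.+1) !=set0.
Proof.
(* Coordinate [n] is free in [box f n]; flipping its bits leaves every cylinder of positive
   length. *)
pose d : dup K := ((fun k => ~~ (f n).1 k), false).
exists (fun j => if j == n then d else f j); split.
  by move=> j jn; rewrite ltn_eqF //; exact: dball_center.
move=> /(_ n (ltnSn n)); rewrite eqxx => -[/(_ 0%N isT) + _] /=.
by rewrite /d /=; case: ((f n).1 0%N).
Qed.

(** [h] prepends [n] isolated points and [r] drops the first [n] terms; the range fixes finitely
    many coordinates at isolated points, hence is clopen. *)
Lemma box_embed (V : set X) : open V -> V !=set0 ->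
  exists h r : X -> X, [/\ continuous h, continuous r, cancel h r,
    clopen (range h) & range h `<=` V].
Proof.
move=> Vo [f Vf].
have [n nV] : exists n, box f n `<=` V by apply: box_base; exact: open_nbhs_nbhs.
have /choice[d dP] : forall j, exists d, dball (f j) n d /\ open [set d].
  by move=> j; have [d ? ?] := isolated_dense (f j) n; exists d.
pose h (g : X) : X := fun j => if (j < n)%N then d j else g (j - n)%N.
pose r (g : X) : X := fun j => g (j + n)%N.
have rangeE : range h = [set g : X | forall j, (j < n)%N -> g j = d j].
  apply/seteqP; split=> [_ [g _ <-] j jn|g gd]; first by rewrite /h jn.
  exists (r g) => //; apply/funext => j; rewrite /h /r.
  by case: ltnP => [/gd//|nj]; rewrite subnK.
exists h, r; split.
- apply: ptws_continuous => j; rewrite /h; case: (ltnP j n) => _.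
    exact: cst_continuous.
  exact: ptws_eval_continuous.
- by apply: ptws_continuous => j; exact: ptws_eval_continuous.
- by move=> g; apply/funext => j; rewrite /r /h ltnNge leq_addl /= addnK.
- have cl j : clopen [set g : X | g j = d j].
    apply: (@preimage_clopen X (dup K) (fun g => g j) [set d j]).
      split; first exact: (dP j).2.
      exact: (accessible_closed_set1 (hausdorff_accessible (dup_hausdorff Kx Kloc))).
    exact: ptws_eval_continuous.
  by rewrite rangeE; exact: clopen_forall_lt.
- rewrite rangeE => g gd; apply: nV => j jn; rewrite gd //; exact: (dP j).1.
Qed.

Lemma power_homogeneous : homogeneous X.
Proof.
apply: (@homogeneous_of_embeddings X box).
- exact: box0.
- exact: clopen_box.
- exact: box_center.
- exact: box_le.
- exact: box_base.
- exact: box_sep.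
- exact: box_strict.
- exact: box_embed.
Qed.

(** * Topological properties of the power and of its finite powers *)

Lemma power_first_countable : first_countable X.
Proof.
move=> f; exists (range (box f)); split.
- exact: (sub_countable (card_image_le _ _)).
- by move=> _ [n _ <-]; apply: open_nbhs_nbhs; split;
    [have [] := clopen_box f n | exact: box_center].
- by move=> U /box_base[n nU]; exists (box f n) => //; exists n.
Qed.

Lemma power_zero_dim : zero_dim X.
Proof.
move=> f U /box_base[n nU]; exists (box f n); split => //.
  exact: clopen_box.
exact: box_center.
Qed.

Lemma power_compact : compact [set: X].
Proof.
have := @tychonoff nat (fun=> dup K) (fun=> setT) (fun=> @dup_compact K).
by rewrite (_ : [set f | _] = setT) //; apply/seteqP; split.
Qed.

Lemma power_hausdorff : hausdorff_space X.
Proof.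
exact: (@hausdorff_product nat (fun=> dup K) (fun=> dup_hausdorff Kx Kloc)).
Qed.

Lemma fpower_regular n : regular_space {ptws 'I_n -> X}.
Proof.
move=> f; apply: (@compact_regular _ f setT).
- exact: (@hausdorff_product 'I_n (fun=> X) (fun=> power_hausdorff)).
- have := @tychonoff 'I_n (fun=> X) (fun=> setT) (fun=> power_compact).
  by rewrite (_ : [set f | _] = setT) //; apply/seteqP; split.
- exact: filterT.
Qed.

(** On the refined points, embedded as constant sequences, each [U x] traces the countable set
    [K x], so countably many of them cannot cover. *)
Lemma fpower_not_lindelof n : (0 < n)%N ->
  exists A : set {ptws 'I_n -> X}, ~ lindelof_subspace A.
Proof.
case: n => // n _.
pose U (x : bits) : set {ptws 'I_n.+1 -> X} :=
  [set f | ladder_copy K x (f ord0 0%N)].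
pose e (x : bits) : {ptws 'I_n.+1 -> X} := fun _ _ => (x, false).
have Uo x : open (U x).
  have [fo _] := clopen_ladder_copy Kloc x.
  apply: (@open_comp {ptws 'I_n.+1 -> X} (dup K) (fun f => f ord0 0%N)) => // f _.
  apply: (@continuous_comp {ptws 'I_n.+1 -> X} X (dup K)
    (fun f => f ord0) (fun g => g 0%N)); exact: ptws_eval_continuous.
exists (range e) => /(_ (range U)) [].
- by move=> _ [x _ <-]; exact: Uo.
- by move=> _ [x _ <-]; exists (U x); [exists x | split => //; exact: Kx].
move=> D [cD DU] eD.
have [y _ ny] : exists2 y, agree 0 (fun=> true) y &
    ~ (\bigcup_(V in D) [set x | V (e x)]) y.
  apply: countable_avoid; apply: bigcup_countable => // V /DU[x _ <-].
  apply: (sub_countable _ (K_countable x)); apply: subset_card_le => z /=.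
  by case.
by apply: ny; have [V DV Ve] := eD _ (imageT e y); exists V.
Qed.

End DupPower.

(** * Hereditary separability *)

Section HereditarilySeparable.
Variables (lt : bits -> bits -> Prop) (K : bits -> set bits).
Hypothesis tr : forall x y z, lt x y -> lt y z -> lt x z.
Hypothesis tri : forall x y, [\/ x = y, lt x y | lt y x].
Hypothesis cnt : forall x, countable [set y | lt y x].
Hypothesis Kx : forall x, K x x.
Hypothesis Klad : forall x, ladder lt K x (K x).

Lemma exists_lt_max (I : eqType) (H : seq I) (x : I -> bits) : H != [::] ->
  exists2 i, i \in H & forall j, j \in H -> x j = x i \/ lt (x j) (x i).
Proof.
elim: H => // h [_ _|h' H IH _].
  by exists h => [|j]; rewrite ?mem_head // inE => /eqP ->; left.
have [//|i iH imax] := IH; case: (tri (x h) (x i)) => xhi.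
- exists i; first by rewrite inE iH orbT.
  by move=> j; rewrite inE => /orP[/eqP ->|/imax//]; left.
- exists i; first by rewrite inE iH orbT.
  by move=> j; rewrite inE => /orP[/eqP ->|/imax//]; right.
- exists h; first exact: mem_head.
  move=> j; rewrite inE => /orP[/eqP ->|/imax[->|ji]]; [by left|by right|].
  by right; exact: tr ji xhi.
Qed.

Variables (T : Type) (ev : T -> nat -> dup K).

(** Separability of [A] at the coordinates in [F] only, relativised to [P] so that [A] can be
    treated in countably many pieces; [A'] may leave [P]. *)
Definition separates_on (F : seq nat) (A P : set T) : Prop :=
  exists A' : set T, [/\ countable A', A' `<=` A &
    forall a, A a -> P a -> forall l, exists2 a', A' a' &
      forall j, j \in F -> dball (ev a j) l (ev a' j)].

Lemma separates_onU F A (I : Type) (D : set I) (P : I -> set T) :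
  countable D -> (forall i, D i -> separates_on F A (P i)) ->
  separates_on F A (\bigcup_(i in D) P i).
Proof.
move=> cD sep.
have /choice[A' A'P] : forall i, exists A', D i -> [/\ countable A', A' `<=` A &
    forall a, A a -> P i a -> forall l, exists2 a', A' a' &
      forall j, j \in F -> dball (ev a j) l (ev a' j)].
  move=> i; have [/sep[A' A'P]|nD] := pselect (D i); first by exists A'.
  by exists set0 => /nD.
exists (\bigcup_(i in D) A' i); split.
- by apply: bigcup_countable => // i /A'P[].
- by move=> a [i /A'P[_ A'A _]] /A'A.
- move=> a Aa [i Di Pia] l; have [_ _ /(_ a Aa Pia l)[a' A'a' aa']] := A'P i Di.
  by exists a' => //; exists i.
Qed.

Lemma separates_onS F A (P Q : set T) :
  P `<=` Q -> separates_on F A Q -> separates_on F A P.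
Proof.
move=> PQ [A' [cA' A'A A'P]]; exists A'; split => // a Aa /PQ; exact: A'P.
Qed.

(** One term is chosen for each of the countably many patterns of length-[l] prefixes on [F]
    realised in [A]. *)
Lemma dense_sequence (F : seq nat) (A : set T) a0 : A a0 ->
  exists s : nat -> T, (forall t, A (s t)) /\
    forall a l, A a -> exists t, forall j, j \in F ->
      agree l (ev a j).1 (ev (s t) j).1.
Proof.
move=> Aa0.
pose code l a : seq (seq bool) := [seq mkseq (ev a j).1 l | j <- F].
have /choice[s sP] : forall n, exists b, A b /\
    forall l c, unpickle n = Some (l, c) ->
      forall a, A a -> code l a = c -> code l b = c.
  move=> n; case E: (unpickle n) => [[l c]|]; last by exists a0.
  have [[a [Aa aE]]|na] := pselect (exists a, A a /\ code l a = c).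
    by exists a; split => // l' c' [<- <-].
  by exists a0; split => // l' c' [<- <-] a Aa ac; case: na; exists a.
exists s; split=> [t|a l Aa]; first exact: (sP t).1.
exists (pickle (l, code l a)) => j jF k kl.
have := (sP (pickle (l, code l a))).2 l (code l a) (pickleK _) a Aa erefl.
move=> /eq_in_map/(_ j jF)/(congr1 (fun s => nth false s k)).
by rewrite !nth_mkseq.
Qed.

Definition typed (F G : seq nat) : set T :=
  [set a | forall j, j \in F -> (ev a j).2 = (j \notin G)].

(* When the refined coordinates of [a] are distinct and exceed the code [e], the
   sets [K] are imposed on them one at a time, in increasing order: the ladder at
   each new coordinate meets the slice cut out by the previous ones. *)
Lemma separates_on_generic (F G : seq nat) (A : set T) : {subset G <= F} ->
  exists xi : bits, separates_on F A
    [set a | [/\ typed F G a, forall j, j \in G -> lt xi (ev a j).1 &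
      {in G &, injective (fun j => (ev a j).1)}]].
Proof.
move=> GF.
have [[a0 Aa0]|nA] := pselect ((A `&` typed F G) !=set0); last first.
  exists (fun=> true), set0; split => // a Aa [aG _ _]; case: nA.
  by exists a.
have [s [sA sdense]] := dense_sequence F Aa0.
pose e : bits := fun m =>
  if unpickle m is Some (t, j, k) then (ev (s t) j).1 k else false.
have eE t j : decode_bits e t j = (ev (s t) j).1.
  by apply/funext => k; rewrite /decode_bits /e pickleK.
(* [xi] lies above the code of the dense sequence and all coordinates of its terms, so these are
   admissible ladder parameters at points beyond [xi]. *)
have [xi xiP] : exists xi, forall x,
    (e |` range (fun tj : nat * nat => (ev (s tj.1) tj.2).1)) x -> lt x xi.
  apply: (countable_bounded cnt tri); apply: countableU => //.
  exact: (sub_countable (card_image_le _ _)).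
exists xi, (range s); split.
- exact: (sub_countable (card_image_le _ _)).
- by move=> _ [t _ <-]; have [] := sA t.
move=> a Aa [aG axi ainj].
have exi : lt e xi by apply: xiP; left.
have sxi t j : lt (decode_bits e t j) xi by apply: xiP; right; exists (t, j).
have aT : (A `&` typed F G) a by [].
have Q n (H : seq nat) : (size H <= n)%N -> {subset H <= G} ->
    forall l, exists t,
      (forall j, j \in F -> agree l (ev a j).1 (decode_bits e t j)) /\
      forall j, j \in H -> K (ev a j).1 (decode_bits e t j).
  elim: n H => [|n IH] H.
    rewrite leqn0 size_eq0 => /eqP -> _ l; have [t tP] := sdense a l aT.
    by exists t; split => // j jF; rewrite eE; exact: tP.
  have [-> _ _ l|H0 Hn HG l] := eqVneq H [::].
    have [t tP] := sdense a l aT.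
    by exists t; split => // j jF; rewrite eE; exact: tP.
  have [i iH imax] := exists_lt_max (fun j => (ev a j).1) H0.
  pose H' := [seq j <- H | j != i].
  have H'n : (size H' <= n)%N.
    rewrite -ltnS; apply: leq_trans Hn; rewrite size_filter -(count_predC (pred1 i) H).
    by rewrite -[ltnLHS]add0n ltn_add2r -has_count has_pred1.
  have H'H : {subset H' <= H} by move=> j; rewrite mem_filter => /andP[].
  have H'G : {subset H' <= G} by move=> j /H'H/HG.
  have H'lt j : j \in H' -> lt (ev a j).1 (ev a i).1.
    rewrite mem_filter /= => /andP[ji jH]; have [xji|//] := imax j jH.
    by move: ji; rewrite (ainj j i (HG _ jH) (HG _ iH) xji) eqxx.
  have [t0 t0P] := sdense a l aT.
  have xii : lt xi (ev a i).1 by apply: axi; exact: HG.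
  (* Ladder parameters must be below [(ev a i).1]. Coordinates of [H'] are, as [i] is the maximum;
     the others are replaced by Euclidean approximations from the sequence. *)
  pose p j := if j \in H' then (ev a j).1 else decode_bits e t0 j.
  have pa j : j \in F -> agree l (p j) (ev a j).1.
    move=> jF; rewrite /p; case: ifP => // _; rewrite eE; apply: agree_sym.
    exact: t0P.
  have iF : i \in F by apply/GF/HG.
  have [_ _ _ /(_ e i l F H' p)] := Klad (ev a i).1.
  case/(_ _ _ _ l).
  - exact: tr xii.
  - move=> j _; rewrite /p; case: ifP => [/H'lt//|_]; exact: tr (sxi _ _) xii.
  - move=> m; have [t [tF tH]] := IH H' H'n H'G (maxn l m).
    exists (decode_bits e t i); split; last first.
      by apply: agree_le (tF _ iF); rewrite leq_maxr.
    split; first exact: tr (sxi _ _) xii.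
    exists t; split => // j jj; last by rewrite /p jj; exact: tH.
    by apply: agree_trans (pa j jj) _; apply: agree_le (tF _ jj); rewrite leq_maxl.
  - move=> z [[_ [t [-> tF tH]]] Kz _]; exists t; split=> [j jF|j jH].
      by apply: agree_trans (tF j jF); apply: agree_sym; exact: pa.
    have [jH'|] := boolP (j \in H'); first by have := tH j jH'; rewrite /p jH'.
    by rewrite mem_filter jH andbT /= negbK => /eqP ->.
move=> l; have [t [tF tG]] := Q _ G (leqnn _) (fun j => id) l.
exists (s t); first by exists t.
move=> j jF; split; first by rewrite /= -eE; exact: tF.
have sG : (ev (s t) j).2 = (j \notin G) by exact: (sA t).2.
rewrite (aG j jF); have [jG|jG] := boolP (j \in G) => /=.
  by split; [rewrite sG jG | rewrite -eE; exact: tG].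
by case; rewrite sG jG.
Qed.

(** Induction on the length of [F]. The pieces where two coordinates coincide, or a refined
    coordinate takes one of countably many small values, reduce to fewer coordinates; the rest is
    generic. *)
Lemma separates_on_all n (F : seq nat) (A : set T) : (size F <= n)%N ->
  separates_on F A setT.
Proof.
elim: n F A => [|n IH] F A Fn.
  have [[a0 Aa0]|nA] := pselect (A !=set0).
    exists [set a0]; split => // [_ ->//|a _ _ l]; exists a0 => // j.
    by move: Fn; rewrite leqn0 size_eq0 => /eqP ->.
  by exists set0; split => // a Aa; case: nA; exists a.
(* Pieces on which coordinate i is determined by the others reduce to F minus i. *)
have frozen i (P : set T) : i \in F ->
    (forall a l a', P a -> P a' ->
      (forall j, j \in rem i F -> dball (ev a j) l (ev a' j)) ->
       dball (ev a i) l (ev a' i)) -> separates_on F A P.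
  move=> iF Pi; have [|A' [cA' A'A A'P]] := IH (rem i F) (A `&` P).
    by rewrite size_rem // -subn1 leq_subLR.
  exists A'; split => // [a /A'A[]//|a Aa Pa l].
  have [a' A'a' aa'] := A'P a (conj Aa Pa) Logic.I l; exists a' => // j.
  rewrite (perm_mem (perm_to_rem iF)) inE => /orP[/eqP ->|]; last exact: aa'.
  by apply: Pi => //; have [] := A'A _ A'a'.
have equal i j : i \in F -> j \in F -> i != j ->
    separates_on F A [set a | ev a i = ev a j].
  move=> iF jF ij; apply: (frozen i) => // a l a' /= -> ->; apply.
  by move: jF; rewrite (perm_mem (perm_to_rem iF)) inE eq_sym (negbTE ij).
have fixed i v : i \in F -> separates_on F A [set a | ev a i = v].
  by move=> iF; apply: (frozen i) => // a l a' /= -> -> _; exact: dball_center.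
have : forall G, exists xi, {subset G <= F} -> separates_on F A
    [set a | [/\ typed F G a, forall j, j \in G -> lt xi (ev a j).1 &
      {in G &, injective (fun j => (ev a j).1)}]].
  move=> G; have [GF|nGF] := pselect {subset G <= F}.
    by have [xi xiP] := separates_on_generic A GF; exists xi.
  by exists (fun=> true) => /nGF.
case/choice=> xi xiP.
pose Peq := \bigcup_(ij in [set ij | [/\ ij.1 \in F, ij.2 \in F & ij.1 != ij.2]])
  [set a | ev a ij.1 = ev a ij.2].
pose small G : set bits := xi G |` [set v | lt v (xi G)].
pose Pfix := \bigcup_(G : seq nat) \bigcup_(v in small G)
  \bigcup_(i in [set i | i \in F]) [set a | ev a i = (v, false)].
pose Pgen := \bigcup_(G in [set G | {subset G <= F}])
  [set a | [/\ typed F G a, forall j, j \in G -> lt (xi G) (ev a j).1 &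
      {in G &, injective (fun j => (ev a j).1)}]].
apply: (@separates_onS _ _ _ (\bigcup_(k in [set: option bool])
  match k with None => Peq | Some true => Pfix | _ => Pgen end)); last first.
  apply: separates_onU => // -[[] _|_].
  - apply: separates_onU => // G _; apply: separates_onU.
      by apply: countableU => //; exact: cnt.
    by move=> v _; apply: separates_onU => [|i]; [exact: countableP | exact: fixed].
  - by apply: separates_onU => [|G]; [exact: countableP | exact: xiP].
  - apply: separates_onU => [|[i j] [/= ? ? ?]]; [exact: countableP | exact: equal].
move=> a _; pose G := [seq j <- F | ~~ (ev a j).2].
have GF : {subset G <= F} by move=> j; rewrite mem_filter => /andP[].
have aj j : j \in G -> ev a j = ((ev a j).1, false).
  by rewrite mem_filter => /andP[+ _]; case: (ev a j) => x [].
have [[j [jG nj]]|large] :=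
  pselect (exists j, j \in G /\ ~ lt (xi G) (ev a j).1).
  exists (Some true) => //; exists G => //; exists (ev a j).1.
    by case: (tri (ev a j).1 (xi G)) => //; [left|right].
  by exists j; [exact: GF | exact: aj].
have [[i [j [iG jG ij aij]]]|inj] := pselect (exists i j,
    [/\ i \in G, j \in G, i != j & (ev a i).1 = (ev a j).1]).
  exists None => //; exists (i, j); first by split => //; exact: GF.
  by rewrite /= (aj i) // (aj j) // aij.
exists (Some false) => //; exists G => //; split.
- by move=> j jF; rewrite mem_filter jF andbT negbK.
- by move=> j jG; apply: contrapT => nj; apply: large; exists j.
- move=> i j iG jG aij; apply/eqP; apply: contrapT => /negP ij.
  by apply: inj; exists i, j.
Qed.

End HereditarilySeparable.

Lemma fpower_hereditarily_separable lt K (n : nat) :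
  (forall x y z, lt x y -> lt y z -> lt x z) ->
  (forall x y, [\/ x = y, lt x y | lt y x]) ->
  (forall x, countable [set y | lt y x]) -> (forall x, K x x) ->
  (forall x, ladder lt K x (K x)) ->
  hereditarily_separable {ptws 'I_n -> {ptws nat -> dup K}}.
Proof.
move=> tr tri cnt Kx Klad A.
pose ev (f : 'I_n -> nat -> dup K) (c : nat) : dup K :=
  if unpickle c is Some (i, j) then f i j else (fun=> false, false).
have /choice[A' A'P] :=
  fun F => separates_on_all tr tri cnt Kx Klad ev A (leqnn (size F)).
exists (\bigcup_(F : seq nat) A' F).
  split; first by apply: bigcup_countable => // F _; have [] := A'P F.
  by move=> f [F _ A'f]; have [_ A'A _] := A'P F; exact: A'A.
move=> f Af U /ptws_box[s [V [fV VU]]].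
have /choice[m mP] := fun i => box_base (fV i).
pose M := \max_(i < n) m i.
(* [M] dominates every [m i], so closeness at radius [M] on these finitely many coded pairs gives
   membership in every box. *)
pose F : seq nat := [seq pickle (i, j) | i <- enum 'I_n, j <- iota 0 M].
have [_ _ /(_ f Af Logic.I M)[g A'g fg]] := A'P F.
exists g; split; first by exists F.
apply: VU => i _; apply: mP => j jm; apply: (dball_le (leq_bigmax i)).
have := fg (pickle (i, j)); rewrite /ev pickleK; apply.
apply: (allpairs_f (fun (i : 'I_n) j => pickle (i, j))); first exact: mem_enum.
by rewrite mem_iota add0n; apply: leq_trans jm (leq_bigmax i).
Qed.

Theorem theorem4p2 : CH ->
  exists X : topologicalType,
    [/\ first_countable X, zero_dim X, compact [set: X],
        homogeneous X & strong_S_space X].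
Proof.
move=> /CH_well_order[lt [wf tr tri cnt]].
have [K KP] := ladders_exist wf tr cnt.
have Kx x : K x x by have [] := KP x.
have Klt x z : K x z -> z = x \/ lt z x by have [_ + _ _] := KP x; apply.
have Kloc x z : locally_coded K (K x) z by have [_ _ + _] := KP x; apply.
have Klad x : ladder lt K x (K x) by have [] := KP x.
exists {ptws nat -> dup K}; split.
- exact: power_first_countable.
- exact: power_zero_dim.
- exact: power_compact.
- exact: (power_homogeneous wf cnt).
- move=> n n0; split.
  + exact: fpower_regular.
  + exact: (@hausdorff_product 'I_n (fun=> {ptws nat -> dup K})
      (fun=> power_hausdorff Kx Kloc)).
  + exact: (@fpower_hereditarily_separable lt K n tr tri cnt Kx Klad).
  + exact: (fpower_not_lindelof cnt Kx Klt Kloc n0).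
Qed.
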